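(* Let $\mathbb{K}\subseteq\mathbb{DN}$. If $\mathbb{PL}\subseteq\mathbb{K}$ or $\mathbb{DM}\subseteq\mathbb{K}$, then $\vdash^{\top}_{\mathbb{K}}$ (and, a fortiori, $\vdash^{\leq}_{\mathbb{K}}$) is not protoalgebraic.
   Context: Language: binary $\land,\lor$, unary $\neg$, constants $\bot,\top$. $\mathbb{DN}$ is the variety of algebras $\langle A;\land,\lor,\neg,\bot,\top\rangle$ with bounded distributive lattice reduct satisfying $\neg\bot\approx\top$ and $\neg(x\lor y)\approx\neg x\land\neg y$. $\mathbb{SDM}$ is its subvariety given additionally by $\neg\top\approx\bot$, $\neg\neg(x\land y)\approx\neg\neg x\land\neg\neg y$, $\neg x\approx\neg\neg\neg x$; $\mathbb{DM}$ is the subvariety of $\mathbb{SDM}$ given by $\neg\neg x\approx x$; $\mathbb{PL}$ (pseudo-complemented distributive lattices) is the subvariety of $\mathbb{SDM}$ given by $x\land\neg(x\land y)\approx x\land\neg y$. For a class $\mathbb{K}$: $\Gamma\vdash^{\leq}_{\mathbb{K}}\varphi$ iff for all $\mathbf{A}\in\mathbb{K}$, all non-empty lattice filters $F$ and all homomorphisms $h$ from the formula algebra to $\mathbf{A}$, $h[\Gamma]\subseteq F$ implies $h(\varphi)\in F$; $\vdash^{\top}_{\mathbb{K}}$ is the logic defined by the matrices $\langle\mathbf{A},\{\top\}\rangle$, $\mathbf{A}\in\mathbb{K}$ (same definition with $F=\{\top\}$). A logic $\vdash$ is protoalgebraic if there is a set $\Delta(p,q)$ of formulas in at most two variables $p,q$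 such that $\vdash\delta(p,p)$ for all $\delta\in\Delta$ and $p,\Delta(p,q)\vdash q$. *)

(* Defs.v *)
From HB Require Import structures.
From mathcomp Require Import all_boot all_order.
From mathcomp Require Import boolp classical_sets.

Set Implicit Arguments.
Unset Strict Implicit.
Unset Printing Implicit Defensive.

Import Order.TTheory.

Local Open Scope order_scope.
Local Open Scope classical_set_scope.

(* The algebras of the signature (/\, \/, neg, bot, top) whose reduct is a
   bounded distributive lattice.  The one-element lattice is allowed.  Library
   lattices carry a choiceType structure, which every type has classically. *)
Record negLattice := NegLattice {
  nl_disp : Order.disp_t;
  nl_sort :> tbDistrLatticeType nl_disp;
  neg : nl_sort -> nl_sort
}.
Arguments neg {n} x.

(* A class of algebras is a plain predicate: [set negLattice] is
   universe-inconsistent, as [set T] is itself a library lattice. *)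
Definition algClass := negLattice -> Prop.

Definition subclass (K L : algClass) : Prop := forall A, K A -> L A.

Record DN (A : negLattice) : Prop := {
  DN_neg_bot : neg \bot = \top :> A;
  DN_neg_join : forall x y : A, neg (x `|` y)%O = (neg x `&` neg y)%O
}.

Record SDM (A : negLattice) : Prop := {
  SDM_DN : DN A;
  SDM_neg_top : neg \top = \bot :> A;
  SDM_negneg_meet : forall x y : A,
    neg (neg (x `&` y)%O) = (neg (neg x) `&` neg (neg y))%O;
  SDM_neg3 : forall x : A, neg x = neg (neg (neg x))
}.

Record DM (A : negLattice) : Prop := {
  DM_SDM : SDM A;
  DM_negK : forall x : A, neg (neg x) = x
}.

Record PL (A : negLattice) : Prop := {
  PL_SDM : SDM A;
  PL_meet_neg : forall x y : A, (x `&` neg (x `&` y))%O = (x `&` neg y)%O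
}.

Inductive form : Type :=
| Var of nat
| And of form & form
| Or of form & form
| Not of form
| Bot
| Top.

Fixpoint vars (f : form) : seq nat :=
  match f with
  | Var n => [:: n]
  | And f1 f2 | Or f1 f2 => vars f1 ++ vars f2
  | Not f1 => vars f1
  | Bot | Top => [::]
  end.

Fixpoint subst (s : nat -> form) (f : form) : form :=
  match f with
  | Var n => s n
  | And f1 f2 => And (subst s f1) (subst s f2)
  | Or f1 f2 => Or (subst s f1) (subst s f2)
  | Not f1 => Not (subst s f1)
  | Bot => Bot
  | Top => Top
  end.

Record is_hom (A : negLattice) (h : form -> A) : Prop := {
  hom_And : forall f g, h (And f g) = (h f `&` h g)%O;
  hom_Or : forall f g, h (Or f g) = (h f `|` h g)%O;
  hom_Not : forall f, h (Not f) = neg (h f);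
  hom_Bot : h Bot = \bot;
  hom_Top : h Top = \top
}.

(* Possibly improper; nonemptiness is required separately. *)
Record lattice_filter (A : negLattice) (F : set A) : Prop := {
  filter_up : forall x y : A, F x -> (x <= y)%O -> F y;
  filter_meet : forall x y : A, F x -> F y -> F (x `&` y)%O
}.

Definition conseq := set form -> form -> Prop.

Definition matrix_logic (M : forall A : negLattice, set A -> Prop) : conseq :=
  fun Gamma phi =>
    forall (A : negLattice) (F : set A), M A F ->
    forall h : form -> A, is_hom h -> h @` Gamma `<=` F -> F (h phi).

Definition logic_le (K : algClass) : conseq :=
  matrix_logic (fun A F => [/\ K A, lattice_filter F & F !=set0]).

Definition logic_top (K : algClass) : conseq :=
  matrix_logic (fun A F => K A /\ F = [set \top]).

(* The distinct variables p and q are those of index 0 and 1. *)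
Definition p_idx : nat := 0.
Definition q_idx : nat := 1.

(* The formula delta(p, p) obtained from delta(p, q). *)
Definition diag (delta : form) : form :=
  subst (fun n => if n == q_idx then Var p_idx else Var n) delta.

Definition protoalgebraic (L : conseq) : Prop :=
  exists Delta : set form,
    [/\ forall delta, Delta delta -> {subset vars delta <= [:: p_idx; q_idx]},
        forall delta, Delta delta -> L set0 (diag delta)
      & L ([set Var p_idx] `|` Delta) (Var q_idx)].

(* Main.v *)
From HB Require Import structures.
From mathcomp Require Import all_boot all_order.
From mathcomp Require Import boolp classical_sets.
Require Import Defs.

(** The refuting matrices live on the three-element chain 0 < a < 1.  With its
    pseudo-complement, negation identifies a with 1, so moving a variable from
    a to 1 can only increase the value of a formula.  With its De Morgan
    involution, every operation is monotone for the order in which a lies below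
    the incomparable elements 0 and 1.  In both cases delta(a, a) = 1 forces
    delta(1, a) = 1, whereas q = a is not designated. *)

Set Implicit Arguments.
Unset Strict Implicit.
Unset Printing Implicit Defensive.

Import Order.TTheory.

Local Open Scope order_scope.
Local Open Scope classical_set_scope.

Fixpoint eval (A : negLattice) (v : nat -> A) (f : form) : A :=
  match f with
  | Var n => v n
  | And f g => eval v f `&` eval v g
  | Or f g => eval v f `|` eval v g
  | Not f => neg (eval v f)
  | Bot => \bot
  | Top => \top
  end%O.

Lemma eval_is_hom (A : negLattice) (v : nat -> A) : is_hom (eval v).
Proof. by split. Qed.

Lemma eval_subst (A : negLattice) (v : nat -> A) s f :
  eval v (subst s f) = eval (fun n => eval v (s n)) f.
Proof. by elim: f => //= [f -> g ->|f -> g ->|f ->]. Qed.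

Lemma eval_diag (A : negLattice) (a : A) f :
  eval (fun=> a) (diag f) = eval (fun=> a) f.
Proof.
rewrite eval_subst; congr (eval _ f).
by apply/funext => n; case: ifP.
Qed.

(** Subalgebras of the square of [A]; the two used below are partial orders, not congruences. *)
Record compatible (A : negLattice) (R : A -> A -> Prop) : Prop := {
  compat_bot : R \bot \bot;
  compat_top : R \top \top;
  compat_neg : forall x y, R x y -> R (neg x) (neg y);
  compat_meet : forall x y x' y',
    R x y -> R x' y' -> R (x `&` x')%O (y `&` y')%O;
  compat_join : forall x y x' y',
    R x y -> R x' y' -> R (x `|` x')%O (y `|` y')%O
}.

Lemma compatible_eval (A : negLattice) (R : A -> A -> Prop) (v w : nat -> A) :
  compatible R -> (forall n, R (v n) (w n)) ->
  forall f, R (eval v f) (eval w f).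
Proof.
move=> [Rb Rt Rn Rm Rj] Rvw.
by elim=> //= [f Rf g Rg|f Rf g Rg|f Rf]; [exact: Rm|exact: Rj|exact: Rn].
Qed.

(** Raising p from [a] to [\top] moves every value along [R], and [R] cannot leave [\top]. So all
    premises of modus ponens hold at ([\top], [a]), while its conclusion is [a]. *)
Lemma compatible_not_protoalgebraic (K : algClass) (A : negLattice)
    (R : A -> A -> Prop) (a : A) :
  K A -> compatible R -> (forall x, R \top x -> x = \top) ->
  R a a -> R a \top -> a <> \top -> ~ protoalgebraic (logic_top K).
Proof.
move=> KA cR Rtop Raa Rat aNtop [Delta [_ Delta_diag Delta_mp]].
pose w n : A := if n == p_idx then \top else a.
apply: aNtop; apply: (Delta_mp A [set \top] (conj KA erefl) _ (eval_is_hom w)).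
move=> x [f [->|Df] <-] //=; apply: Rtop.
have <- : eval (fun=> a) f = \top.
  rewrite -eval_diag.
  apply: (Delta_diag f Df A [set \top] (conj KA erefl) _ (eval_is_hom _)).
  by rewrite image_set0; apply: sub0set.
apply: compatible_eval => // n.
by rewrite /w; case: ifP.
Qed.

(** The singleton of [\top] is a nonempty lattice filter. *)
Lemma logic_le_top (K : algClass) Gamma phi :
  logic_le K Gamma phi -> logic_top K Gamma phi.
Proof.
move=> le_phi A _ [KA ->] h hom_h; apply: le_phi => //.
split=> //; last by exists \top.
by split=> x y -> => [|->]; [rewrite le1x => /eqP|rewrite meetxx].
Qed.

Lemma protoalgebraic_le_top (K : algClass) :
  protoalgebraic (logic_le K) -> protoalgebraic (logic_top K).
Proof.
move=> [Delta [Delta_vars Delta_diag Delta_mp]]; exists Delta; split=> //.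
- by move=> f /Delta_diag; apply: logic_le_top.
- exact: logic_le_top.
Qed.

(* The library equips 'I_n.+1 with its order and its bounds separately; this
   builds their joins. *)
HB.instance Definition _ (n : nat) := Order.Total.on 'I_n.+1.

Definition chain3_pcompl : negLattice :=
  @NegLattice _ (Order.TBDistrLattice.clone _ 'I_3 _)
    (fun x => if x == ord0 then ord_max else ord0).

Definition chain3_invol : negLattice :=
  @NegLattice _ (Order.TBDistrLattice.clone _ 'I_3 _) (@rev_ord 3).

Definition mid3 : 'I_3 := @Ordinal 3 1 isT.

(** Phrased with [\bot] and [\top] so that the laws for bounds rewrite in each case. *)
Lemma ord3_ind (P : 'I_3 -> Prop) :
  P \bot -> P mid3 -> P \top -> forall x, P x.
Proof.
move=> P0 P1 P2 [[|[|[|//]]] lt_x3].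
- by rewrite (_ : Ordinal _ = \bot) //; apply: val_inj.
- by rewrite (_ : Ordinal _ = mid3) //; apply: val_inj.
- by rewrite (_ : Ordinal _ = \top) //; apply: val_inj.
Qed.

Lemma PL_chain3_pcompl : PL chain3_pcompl.
Proof.
split; [split; [split| | |]|] => /=; try by apply: val_inj.
all: elim/ord3_ind; try by apply: val_inj.
all: by elim/ord3_ind; apply: val_inj.
Qed.

Lemma DM_chain3_invol : DM chain3_invol.
Proof.
split; [split; [split| | |]|] => /=; try by apply: val_inj.
all: elim/ord3_ind; try by apply: val_inj.
all: by elim/ord3_ind; apply: val_inj.
Qed.

Lemma compatible_pcompl :
  compatible (fun x y : chain3_pcompl => (x <= y)%O /\ neg x = neg y).
Proof.
split=> //=.
(* Negation reverses the order, but here both negations coincide. *)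
- by move=> x y [_ ->].
- move=> x y x' y' [le_xy exy] [le_xy' exy']; split; first exact: leI2.
  (* What remains is that the kernel of [neg] respects meets, a finite check. *)
  by move: x y x' y' exy exy' {le_xy le_xy'};
    do 4!elim/ord3_ind => //; move=> *; apply: val_inj.
- move=> x y x' y' [le_xy exy] [le_xy' exy']; split; first exact: leU2.
  by move: x y x' y' exy exy' {le_xy le_xy'};
    do 4!elim/ord3_ind => //; move=> *; apply: val_inj.
Qed.

Lemma compatible_invol :
  compatible (fun x y : chain3_invol => x = mid3 \/ x = y).
Proof.
split=> /=; [by right|by right| | |].
- by move=> x y [->|->]; [left; apply: val_inj|right].
- move=> x y x' y' [->|->] [->|->]; [left|..|by right]; first exact: meetxx.
  (* A meet of [mid3] with [\bot] is [\bot] on both sides; with any other element it is [mid3].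
     Joins are dual. *)
  + by elim/ord3_ind: y'; [right; rewrite !meetx0|left|left]; apply: val_inj.
  + by elim/ord3_ind: y; [right; rewrite !meet0x|left|left]; apply: val_inj.
- move=> x y x' y' [->|->] [->|->]; [left|..|by right]; first exact: joinxx.
  + by elim/ord3_ind: y'; [left|left|right; rewrite !joinx1]; apply: val_inj.
  + by elim/ord3_ind: y; [left|left|right; rewrite !join1x]; apply: val_inj.
Qed.

Theorem theorem6p1 (K : algClass) (hK : subclass K DN)
    (hPLDM : subclass PL K \/ subclass DM K) :
  ~ protoalgebraic (logic_top K) /\ ~ protoalgebraic (logic_le K).
Proof.
suff top_np : ~ protoalgebraic (logic_top K).
  by split=> // /protoalgebraic_le_top.
have [KPL|KDM] := hPLDM.
- apply: (compatible_not_protoalgebraic (a := mid3 : chain3_pcompl)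
    (KPL _ PL_chain3_pcompl) compatible_pcompl) => //.
  by move=> x [+ _]; rewrite le1x => /eqP.
- apply: (compatible_not_protoalgebraic (a := mid3 : chain3_invol)
    (KDM _ DM_chain3_invol) compatible_invol) => //; [|by left|by left].
  (* The case [\top = mid3] is absurd on underlying numbers. *)
  by move=> x [/(congr1 val)|->].
Qed.
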